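(* Every path-connected, $\Delta$-Hausdorff topological space is arcwise connected. That is, if $X$ is a path-connected $\Delta$-Hausdorff topological space and $x,y\in X$ with $x\neq y$, then there exists a path $\alpha:[0,1]\to X$ with $\alpha(0)=x$ and $\alpha(1)=y$ which is a topological embedding.
   Context: A path in a topological space $X$ is a continuous function $\alpha:[a,b]\to X$ from a closed real interval. A space $X$ is path connected if for all $x,y\in X$ there exists a path from $x$ to $y$. A space $X$ is arcwise connected if whenever $x\neq y$ in $X$, there exists a path $\alpha:[0,1]\to X$ from $x$ to $y$ which is a topological embedding, i.e. a homeomorphism onto its image. A space $X$ is $\Delta$-Hausdorff if for every path $\alpha:[0,1]\to X$, the image $\alpha([0,1])$ is closed in $X$. (No Hausdorff assumption is made.) *)

(* Defs.v *)
From HB Require Import structures.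
From mathcomp Require Import all_boot all_order all_algebra.
From mathcomp Require Import all_classical all_reals all_analysis.

Set Implicit Arguments.
Unset Strict Implicit.
Unset Printing Implicit Defensive.

Import Order.TTheory GRing.Theory Num.Theory.
Import numFieldNormedType.Exports.

Local Open Scope classical_set_scope.
Local Open Scope ring_scope.

(* Maps defined on a subset are represented by total functions whose values
   outside of the subset are irrelevant: every notion below only depends on
   the restriction to the subset, with its subspace topology. *)

Definition is_path {R : realType} {X : topologicalType} (a b : R)
    (f : R -> X) : Prop :=
  {within `[a, b], continuous f}.

Definition is_path_from_to {R : realType} {X : topologicalType} (a b : R)
    (f : R -> X) (x y : X) : Prop :=
  [/\ is_path a b f, f a = x & f b = y].

Definition homeomorphism_between {S T : topologicalType} (A : set S)
    (B : set T) (f : S -> T) : Prop :=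
  exists g : T -> S,
    [/\ set_fun A B f, set_fun B A g,
        (forall s, A s -> g (f s) = s), (forall t, B t -> f (g t) = t)
      & {within A, continuous f} /\ {within B, continuous g}].

Definition embedding_on {S T : topologicalType} (A : set S)
    (f : S -> T) : Prop :=
  homeomorphism_between A (f @` A) f.

Definition path_connected (R : realType) (X : topologicalType) : Prop :=
  forall x y : X, exists (a b : R) (f : R -> X),
    a <= b /\ is_path_from_to a b f x y.

Definition delta_hausdorff (R : realType) (X : topologicalType) : Prop :=
  forall f : R -> X, is_path 0 1 f -> closed (f @` `[0, 1]).

Definition arcwise_connected (R : realType) (X : topologicalType) : Prop :=
  forall x y : X, x <> y -> exists f : R -> X,
    is_path_from_to 0 1 f x y /\ embedding_on (`[0, 1]%classic : set R) f.

(* Main.v *)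
Require Import Defs.
From mathcomp Require Import all_boot all_order all_algebra.
From mathcomp Require Import all_classical all_reals all_analysis.
From mathcomp Require Import lra.

(** A path [f] from [x] to [y] is made injective in two steps, and an injective
path in a Delta-Hausdorff space is automatically an embedding.

Erasing loops. Images of compact intervals under a path are closed, and so are
points; hence two parameters with different values have neighbourhoods on which
[f] never takes a common value ([separated_values]): although [X] need not be
Hausdorff, the relation [f s = f t] is closed. Consider the open sets [U] of
the open unit interval such that [f] takes the same value at both ends of each
component of [U]. Closedness of the relation and compactness show that these
sets are stable under unions of chains ([loop_set_bigcup]), so Zorn's lemma
gives a maximal one. Making [f] constant on each component of the maximal [U]
yields a continuous [g] with the same end points, and maximality says exactly
that the fibers of [g] are intervals ([monotone_path_exists]).

Reparametrizing. A path [g] whose fibers are closed intervals factors through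
an order-preserving collapse of the unit interval. The collapse is a staircase
function [h], built by bisection: cut at the fiber of the midpoint, give both
remaining pieces half of the total height, and iterate. The lengths of the
pieces are at least halved at each step, which makes [h] separate different
fibers, while the heights are exactly halved, which makes [h] continuous and
constant on fibers ([fiber_coordinate]). As [h] is a quotient map from a compact
interval, [g] composed with any section of [h] is a continuous injective path
([injective_reparametrization]).

Embedding. If [c] is an injective path, then the image of a relatively open
interval is the complement, in the image of [c], of the images of two compact
intervals, which are closed in [X]; so the inverse of [c] is continuous
([injective_path_embedding]). *)

Set Implicit Arguments.
Unset Strict Implicit.
Unset Printing Implicit Defensive.

Import Order.TTheory GRing.Theory Num.Theory.
Import numFieldNormedType.Exports.

Local Open Scope classical_set_scope.
Local Open Scope ring_scope.

(** * Bisection of an interval along the fibers of a map *)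

(** The fibers of [g] in the unit interval are intervals. *)
Definition convex_fibers {R : realType} {T : Type} (g : R -> T) :=
  forall s u t, 0 <= s -> s <= u -> u <= t -> t <= 1 -> g s = g t -> g u = g s.

(** [lo t] and [hi t] are the least and the greatest element of the fiber of
[t] in the unit interval; nothing is said for [t] outside of it. *)
Definition fiber_ends {R : realType} {T : Type} (g : R -> T) (lo hi : R -> R) :=
  forall t, 0 <= t <= 1 ->
    [/\ 0 <= lo t <= t, t <= hi t <= 1, g (lo t) = g t, g (hi t) = g t
      & forall s, 0 <= s <= 1 -> g s = g t -> lo t <= s <= hi t].

(** In the unit interval, [l] is the greatest element of its fiber and [r] is the
least element of its own: the interval from [l] to [r] has no other point in
common with the fibers of its end points. *)
Definition fiber_gap {R : realType} {T : Type} (g : R -> T) (l r : R) :=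
  [/\ 0 <= l, l < r, r <= 1,
      forall t, 0 <= t <= 1 -> g t = g l -> t <= l
    & forall t, 0 <= t <= 1 -> g t = g r -> r <= t].

(** A rate for the two halvings of the bisection: heights and lengths. *)
Lemma exp_half_le {R : realType} (e : R) : 0 < e -> exists k, 2^-1 ^+ k <= e.
Proof.
move=> e0.
have h1 : `|2^-1 : R| < 1 by rewrite gtr0_norm ?invr_gt0//; lra.
have /cvgrPdist_lt/(_ e e0) := cvg_expr h1.
case=> k _ /(_ k (leqnn k)) /=; rewrite sub0r normrN normrX gtr0_norm ?invr_gt0//.
by move=> /ltW; exists k.
Qed.

Section Staircase.
Context {R : realType} {T : Type} (g : R -> T) (lo hi : R -> R).

(** The [k]-th approximation of the staircase on [l, r]. The interval is cut at the
fiber of its midpoint, and each of the two remaining intervals carries half of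
the height. Every approximation is 0 left of [l] and 1 from [r] on, so the
approximation of order [k.+1] on the whole line is the mean of those of order
[k] on the two halves. *)
Fixpoint stair_approx (k : nat) (l r t : R) : R :=
  if k is k'.+1 then
    let m := (l + r) / 2 in
    (stair_approx k' l (lo m) t + stair_approx k' (hi m) r t) / 2
  else ((r <= t)%R : bool)%:R.

Lemma stair_approx_ge0_le1 k l r t :
  0 <= stair_approx k l r t <= 1.
Proof.
elim: k l r => [|k IH] l r /=; first by rewrite ler0n lern1 leq_b1.
have := IH l (lo ((l + r) / 2)); have := IH (hi ((l + r) / 2)) r; lra.
Qed.

Lemma stair_approx_nd k l r :
  {homo stair_approx k l r : s t / s <= t}.
Proof.
move=> s t st; elim: k l r => [|k IH] l r /=.
  by rewrite ler_nat; case: (leP r s) => // rs; rewrite (le_trans rs st).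
have := IH l (lo ((l + r) / 2)); have := IH (hi ((l + r) / 2)) r; lra.
Qed.

(** The staircase on [l, r] is the limit of the approximations, which increase with
[k]. *)
Definition stair (l r t : R) : R :=
  limn (fun k => stair_approx k l r t).

Context (cg : convex_fibers g) (eg : fiber_ends g lo hi).

(** The fiber of the midpoint lies strictly inside [l, r], and the two intervals
that it leaves are again of the same kind; each is at most half as long. *)
Lemma fiber_gap_split l r :
  fiber_gap g l r ->
  let m := (l + r) / 2 in
  [/\ l < lo m, lo m <= m <= hi m, hi m < r,
      fiber_gap g l (lo m) & fiber_gap g (hi m) r].
Proof.
move=> [l0 lr r1 gl gr] m.
have lm : l < m by rewrite /m; lra.
have mr : m < r by rewrite /m; lra.
have m01 : 0 <= m <= 1 by apply/andP; split; lra.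
have [/andP[lo0 lom] /andP[mhi hi1] glo ghi mF] := eg m01.
have llo : l < lo m.
  rewrite ltNge; apply/negP => lol.
  have e : g l = g m by rewrite -glo (cg (s := lo m) (u := l) (t := m))//; lra.
  have := gl m m01 (esym e); lra.
have hir : hi m < r.
  rewrite ltNge; apply/negP => rhi.
  have e : g r = g m by apply: (cg (s := m) (u := r) (t := hi m)) => //; lra.
  have := gr m m01 (esym e); lra.
split => //; first by rewrite lom mhi.
- split => //; first by lra.
  by move=> t t01; rewrite glo => /(mF _ t01)/andP[].
- split => //; first by lra.
  by move=> t t01; rewrite ghi => /(mF _ t01)/andP[].
Qed.

Lemma stair_approx_out k l r t :
  fiber_gap g l r ->
  (t <= l -> stair_approx k l r t = 0) /\
  (r <= t -> stair_approx k l r t = 1).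
Proof.
elim: k l r => [|k IH] l r gd /=.
  split=> [tl|->//]; case: gd => _ lr _ _ _.
  by rewrite leNgt (le_lt_trans tl lr).
have [llo lohi hir g1 g2] := fiber_gap_split gd.
set m := (l + r) / 2 in llo lohi hir g1 g2 *.
have [a0 a1] := IH _ _ g1; have [b0 b1] := IH _ _ g2.
split=> h.
- by rewrite a0// b0; lra.
- by rewrite a1 ?b1; lra.
Qed.

Lemma stair_approx_incr k l r t :
  fiber_gap g l r ->
  stair_approx k l r t <= stair_approx k.+1 l r t.
Proof.
elim: k l r => [|k IH] l r gd.
  have [llo lohi hir g1 g2] := fiber_gap_split gd.
  rewrite /=; set m := (l + r) / 2 in llo lohi hir g1 g2 *.
  case: (leP r t) => rt; last by rewrite addr0 divr_ge0 ?ler0n.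
  have -> : lo m <= t by lra.
  lra.
have [llo lohi hir g1 g2] := fiber_gap_split gd.
have := IH _ _ g1; have := IH _ _ g2.
have E j : stair_approx j.+1 l r t =
  (stair_approx j l (lo ((l + r) / 2)) t +
   stair_approx j (hi ((l + r) / 2)) r t) / 2 by [].
rewrite (E k) (E k.+1).
lra.
Qed.

Lemma stair_cvg l r t :
  fiber_gap g l r ->
  cvgn (fun k => stair_approx k l r t).
Proof.
move=> gd; apply: nondecreasing_is_cvgn.
  by apply/nondecreasing_seqP => k; exact: stair_approx_incr gd.
by exists 1 => _ [k _ <-]; case/andP: (stair_approx_ge0_le1 k l r t).
Qed.

Lemma stair_out l r t :
  fiber_gap g l r ->
  (t <= l -> stair l r t = 0) /\ (r <= t -> stair l r t = 1).
Proof.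
move=> gd; rewrite /stair; split => h.
- rewrite (_ : (fun k => _) = cst 0) ?lim_cst//.
  by apply/funext => k; apply: (stair_approx_out k t gd).1.
- rewrite (_ : (fun k => _) = cst 1) ?lim_cst//.
  by apply/funext => k; apply: (stair_approx_out k t gd).2.
Qed.

Lemma stair_nd l r :
  fiber_gap g l r ->
  {homo stair l r : s t / s <= t}.
Proof.
move=> gd s t st; apply: ler_lim.
- exact: stair_cvg gd.
- exact: stair_cvg gd.
- by apply: nearW => k; exact: stair_approx_nd.
Qed.

(** Self-similarity of the staircase: all of its properties below follow from
this equation, the values outside of [l, r] and monotonicity. *)
Lemma stair_rec l r t :
  fiber_gap g l r ->
  let m := (l + r) / 2 in
  stair l r t = (stair l (lo m) t + stair (hi m) r t) / 2.
Proof.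
move=> gd m.
have [llo lohi hir g1 g2] := fiber_gap_split gd.
apply: cvg_lim => //; rewrite -cvg_shiftS /=.
by apply: cvgMl; apply: cvgD; [exact: stair_cvg g1|exact: stair_cvg g2].
Qed.

Lemma stair_ge0_le1 l r t :
  fiber_gap g l r ->
  0 <= stair l r t <= 1.
Proof.
move=> gd; have nd := stair_nd gd.
apply/andP; split.
- have [tl|lt] := leP t l; first by rewrite (stair_out t gd).1.
  by rewrite -((stair_out l gd).1 (lexx l)); exact/nd/ltW.
- have [rt|tr] := leP r t; first by rewrite (stair_out t gd).2.
  by rewrite -((stair_out r gd).2 (lexx r)); exact/nd/ltW.
Qed.

(** Between [t] and any [s] close to it, at most one of the two terms in [stair_rec]
changes, so the bound on the oscillation is halved at each step. *)
Lemma stair_osc k l r (t : R) :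
  fiber_gap g l r ->
  \forall s \near t, `|stair l r t - stair l r s| <= 2^-1 ^+ k.
Proof.
elim: k l r => [|k IH] l r gd.
  near=> s; rewrite expr0 ler_norml.
  have := stair_ge0_le1 s gd; have := stair_ge0_le1 t gd; lra.
have [llo lohi hir g1 g2] := fiber_gap_split gd.
have E := fun s => stair_rec s gd; move: E => /= E.
set m := (l + r) / 2 in llo lohi hir g1 g2 E *.
have O1 := fun s => stair_out s g1; have O2 := fun s => stair_out s g2.
have D : \forall s \near t, (lo m <= t /\ lo m <= s) \/ (t <= hi m /\ s <= hi m).
  have [th|ht] := ltP t (hi m).
    near=> s; right; split; first exact: ltW.
    by near: s; apply: filterS (lt_nbhsl th) => s /ltW.
  have [lt|tl] := ltP (lo m) t.
    near=> s; left; split; first exact: ltW.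
    by near: s; apply: filterS (lt_nbhsr lt) => s /ltW.
  near=> s; case: (leP (lo m) s) => h; [left|right]; lra.
near=> s; rewrite exprS !E.
have d1 : `|stair l (lo m) t - stair l (lo m) s| <= 2^-1 ^+ k.
  by near: s; exact: IH.
have d2 : `|stair (hi m) r t - stair (hi m) r s| <= 2^-1 ^+ k.
  by near: s; exact: IH.
have : (lo m <= t /\ lo m <= s) \/ (t <= hi m /\ s <= hi m) by near: s.
move: d1 d2; rewrite !ler_norml => d1 d2 [[a b]|[a b]].
- rewrite (O1 t).2// (O1 s).2//; lra.
- rewrite (O2 t).1// (O2 s).1//; lra.
Unshelve. all: by end_near. Qed.

Lemma stair_continuous l r :
  fiber_gap g l r ->
  continuous (stair l r).
Proof.
move=> gd t; apply/cvgrPdist_le => e e0.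
have [k ke] := exp_half_le e0.
by apply: filterS (stair_osc k t gd) => s /le_trans; apply.
Qed.

(** A fiber other than that of the midpoint lies on one side of it, so here
too at most one term in [stair_rec] changes. *)
Lemma stair_fiber l r s t :
  fiber_gap g l r ->
  0 <= s <= 1 -> 0 <= t <= 1 -> g s = g t ->
  stair l r s = stair l r t.
Proof.
move=> gd s01 t01 gst.
suff B k : `|stair l r s - stair l r t| <= 2^-1 ^+ k.
  apply/eqP; rewrite -subr_eq0 -normr_le0; apply/ler_addgt0Pl => e e0.
  have [k ke] := exp_half_le e0.
  by rewrite addr0 (le_trans (B k)).
elim: k l r gd => [|k IH] l r gd.
  rewrite expr0 ler_norml.
  have := stair_ge0_le1 s gd; have := stair_ge0_le1 t gd; lra.
have [llo lohi hir g1 g2] := fiber_gap_split gd.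
rewrite !(stair_rec _ gd).
set m := (l + r) / 2 in llo lohi hir g1 g2 *.
have m01 : 0 <= m <= 1 by case: gd => *; rewrite /m; lra.
have [/andP[lo0 lom] /andP[mhi hi1] glo ghi mF] := eg m01.
have O1 := fun s => stair_out s g1; have O2 := fun s => stair_out s g2.
have : (lo m <= s /\ lo m <= t) \/ (s <= hi m /\ t <= hi m).
  have [e|ne] := pselect (g s = g m).
    by left; case/andP: (mF _ s01 e); case/andP: (mF _ t01 (etrans (esym gst) e)).
  have [a|a] := leP (lo m) s; have [b|b] := leP (lo m) t.
  - by left.
  - have [c|c] := leP s (hi m); first by right; lra.
    by case: ne; rewrite gst; apply/esym/(cg (s := t) (u := m) (t := s)) => //; lra.
  - have [c|c] := leP t (hi m); first by right; lra.
    by case: ne; apply/esym/(cg (s := s) (u := m) (t := t)) => //; lra.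
  - by right; lra.
have := IH _ _ g1; have := IH _ _ g2; rewrite exprS !ler_norml => d1 d2.
case=> [[a b]|[a b]].
- rewrite (O1 t).2// (O1 s).2//; lra.
- rewrite (O2 t).1// (O2 s).1//; lra.
Qed.

(** By induction on a bound for the ratio of [r - l] to [t - l], which is halved
when passing to the left half. *)
Lemma stair_gt0 l r t : fiber_gap g l r -> l < t -> 0 < stair l r t.
Proof.
move=> gd lt.
have [k] : exists k, 2^-1 ^+ k <= t - l by apply: exp_half_le; lra.
move=> kt; have : 2^-1 ^+ k * (r - l) <= t - l.
  by apply: le_trans kt; rewrite ler_piMr ?exprn_ge0//; case: gd => *; lra.
elim: k l r gd lt {kt} => [|k IH] l r gd lt.
  rewrite expr0 => h; rewrite (stair_out t gd).2; lra.
have [llo lohi hir g1 g2] := fiber_gap_split gd.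
rewrite (stair_rec t gd) exprS; set m := (l + r) / 2 in llo lohi hir g1 g2 *.
have := stair_ge0_le1 t g1; have := stair_ge0_le1 t g2 => b1 b2.
have [lot|tlo] := leP (lo m) t; first by rewrite (stair_out t g1).2//; lra.
move=> h; suff : 0 < stair l (lo m) t by lra.
apply: IH => //; apply: le_trans h; rewrite -mulrA mulrCA.
by rewrite ler_wpM2l ?exprn_ge0 ?invr_ge0//; rewrite /m in lohi *; lra.
Qed.

Lemma stair_lt1 l r t : fiber_gap g l r -> t < r -> stair l r t < 1.
Proof.
move=> gd lt.
have [k] : exists k, 2^-1 ^+ k <= r - t by apply: exp_half_le; lra.
move=> kt; have : 2^-1 ^+ k * (r - l) <= r - t.
  by apply: le_trans kt; rewrite ler_piMr ?exprn_ge0//; case: gd => *; lra.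
elim: k l r gd lt {kt} => [|k IH] l r gd lt.
  rewrite expr0 => h; rewrite (stair_out t gd).1; lra.
have [llo lohi hir g1 g2] := fiber_gap_split gd.
rewrite (stair_rec t gd) exprS; set m := (l + r) / 2 in llo lohi hir g1 g2 *.
have := stair_ge0_le1 t g1; have := stair_ge0_le1 t g2 => b1 b2.
have [thi|hit] := leP t (hi m); first by rewrite (stair_out t g2).1//; lra.
move=> h; suff : stair (hi m) r t < 1 by lra.
apply: IH => //; apply: le_trans h; rewrite -mulrA mulrCA.
by rewrite ler_wpM2l ?exprn_ge0 ?invr_ge0//; rewrite /m in lohi *; lra.
Qed.

(** The staircase separates fibers. While [s] and [t] are on the same side of the
midpoint fiber, [t - s] is fixed and the length of the interval is halved, so
they are eventually cut apart. *)
Lemma stair_lt l r s t : fiber_gap g l r ->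
  l <= s -> s < t -> t <= r -> g s <> g t -> stair l r s < stair l r t.
Proof.
move=> gd ls st tr gst.
have [k] : exists k, 2^-1 ^+ k <= t - s by apply: exp_half_le; lra.
move=> kt; have : 2^-1 ^+ k * (r - l) <= t - s.
  by apply: le_trans kt; rewrite ler_piMr ?exprn_ge0//; case: gd => *; lra.
elim: k l r gd ls tr {kt} => [|k IH] l r gd ls tr.
  rewrite expr0 => h; rewrite (stair_out s gd).1 ?(stair_out t gd).2; lra.
have [llo lohi hir g1 g2] := fiber_gap_split gd.
rewrite !(stair_rec _ gd) exprS.
have m01 : 0 <= (l + r) / 2 <= 1 by case: gd => *; lra.
have [/andP[lo0 lom] /andP[mhi hi1] glo ghi mF] := eg m01.
set m := (l + r) / 2 in llo lohi hir g1 g2 m01 lo0 lom mhi hi1 glo ghi mF *.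
move=> h.
have n1 := stair_nd g1 (ltW st); have n2 := stair_nd g2 (ltW st).
have [tlo|lot] := leP t (lo m).
  suff : stair l (lo m) s < stair l (lo m) t by lra.
  apply: IH => //; apply: le_trans h; rewrite -mulrA mulrCA.
  by rewrite ler_wpM2l ?exprn_ge0 ?invr_ge0//; rewrite /m in lohi *; lra.
have [his|shi] := leP (hi m) s.
  suff : stair (hi m) r s < stair (hi m) r t by lra.
  apply: IH => //; apply: le_trans h; rewrite -mulrA mulrCA.
  by rewrite ler_wpM2l ?exprn_ge0 ?invr_ge0//; rewrite /m in lohi *; lra.
have [slo|los] := ltP s (lo m).
  by have := stair_lt1 g1 slo; rewrite (stair_out t g1).2 ?(ltW lot)// in n1 *; lra.
have [hit|thi] := ltP (hi m) t.
  by have := stair_gt0 g2 hit; rewrite (stair_out s g2).1 ?(ltW shi)// in n2 *; lra.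
have e u : lo m <= u -> u <= hi m -> g u = g (lo m).
  by move=> a b; apply: (cg (t := hi m)) => //; rewrite glo ghi.
by case: gst; rewrite (e s) ?(e t)//; lra.
Qed.

End Staircase.

(** A continuous coordinate on the unit interval whose level sets are exactly the
fibers of [g]. *)
Lemma fiber_coordinate {R : realType} {T : Type} (g : R -> T) (lo hi : R -> R) :
  convex_fibers g -> fiber_ends g lo hi -> g 0 <> g 1 ->
  exists h : R -> R, [/\ continuous h, h 0 = 0, h 1 = 1 &
    forall s t, 0 <= s <= 1 -> 0 <= t <= 1 -> (h s = h t <-> g s = g t)].
Proof.
move=> cg pP g01.
have zin : 0 <= (0 : R) <= 1 by rewrite lexx ler01.
have oin : 0 <= (1 : R) <= 1 by rewrite lexx ler01.
have [_ /andP[l0 l1] _ gl lF] := pP 0 zin.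
have [/andP[r0 r1] _ gr _ rF] := pP 1 oin.
(* the staircase rises from the end of the fiber of 0 to the start of that of 1 *)
set l := hi 0 in l0 l1 gl lF; set r := lo 1 in r0 r1 gr rF.
have lr : l < r.
  rewrite ltNge; apply/negP => rl; apply: g01.
  by rewrite -gr; apply/esym/(cg 0 r l).
have gd : fiber_gap g l r.
  split => //; first by move=> t t01; rewrite gl => /(lF _ t01)/andP[].
  by move=> t t01; rewrite gr => /(rF _ t01)/andP[].
pose h := stair lo hi l r.
have hout := fun t => stair_out cg pP t gd.
have h0 : h 0 = 0 by apply: (hout 0).1.
have h1 : h 1 = 1 by apply: (hout 1).2.
have ch : continuous h by exact: (stair_continuous cg pP gd).
have hg s t : 0 <= s <= 1 -> 0 <= t <= 1 -> h s = h t -> g s = g t.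
  wlog st : s t / s <= t.
    move=> W s01 t01 e; have [st|/ltW ts] := leP s t; first exact: W.
    by apply/esym/W.
  move=> /andP[s0 s1] /andP[t0 t1] e; apply: contrapT => gst.
  have {}st : s < t.
    by rewrite lt_neqAle st andbT; apply/eqP => st'; rewrite st' in gst.
  have lt : l < t.
    rewrite ltNge; apply/negP => tl; apply: gst.
    by rewrite (cg 0 t l)// (cg 0 s l)//; lra.
  have sr : s < r.
    rewrite ltNge; apply/negP => rs; apply: gst.
    by rewrite (cg r s 1)// (cg r t 1)//; lra.
  (* s and t are moved into [l, r] without leaving their fibers *)
  have [s' [ls' s'r s't hs' gs']] :
      exists s', [/\ l <= s', s' < r, s' < t, h s' = h s & g s' = g s].
    have [ls|sl] := leP l s; first by exists s.
    have e' : g l = g s by rewrite gl (cg 0 s l)//; lra.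
    by exists l; split => //; apply: (stair_fiber cg pP gd) => //; lra.
  have [t' [t'r s't' ht' gt']] :
      exists t', [/\ t' <= r, s' < t', h t' = h t & g t' = g t].
    have [tr|rt] := leP t r; first by exists t.
    have e' : g r = g t by rewrite (cg r t 1)//; lra.
    by exists r; split => //; apply: (stair_fiber cg pP gd) => //; lra.
  have : h s' < h t' by apply: (stair_lt cg pP gd) => //; rewrite gs' gt'.
  by rewrite hs' ht' e ltxx.
exists h; split => // s t s01 t01; split; first exact: hg.
exact: (stair_fiber cg pP gd).
Qed.

(** * Extremal points of closed sets, and truncation to the unit interval *)

(** A closed set with a point at or before [m] has a last point at or before [m]. *)
Lemma closed_last_point {R : realType} (K : set R) (s m : R) :
  closed K -> K s -> s <= m ->
  exists a, [/\ K a, s <= a, a <= m & forall u, a < u -> u <= m -> ~ K u].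
Proof.
move=> cK Ks sm; pose A := K `&` [set u | u <= m].
have cA : closed A by apply: closedI => //; exact: closed_le.
have As : A s by [].
have ubA : ubound A m by move=> u [].
have [Ka am] := cA _ (closure_sup (ex_intro _ s As) (ex_intro _ m ubA)).
exists (sup A); split => //; first by apply: (ub_le_sup _ As); exists m.
move=> u au um Ku; suff : u <= sup A by rewrite leNgt au.
by apply: ub_le_sup; [exists m|].
Qed.

(** A closed set with a point at or after [m] has a first point at or after [m]. *)
Lemma closed_first_point {R : realType} (K : set R) (m s : R) :
  closed K -> K s -> m <= s ->
  exists a, [/\ K a, m <= a, a <= s & forall u, m <= u -> u < a -> ~ K u].
Proof.
move=> cK Ks ms.
have cK' : closed (-%R @^-1` K).
  by apply: closed_comp => // x _; exact: opp_continuous.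
have [||a [Ka sa am H]] := @closed_last_point R _ (- s) (- m) cK'.
- by rewrite /preimage /= opprK.
- by rewrite lerN2.
exists (- a); split => //; [by lra|by lra|move=> u mu ua Ku].
by apply: (H (- u)); [lra|lra|rewrite /preimage /= opprK].
Qed.

(** The retraction of the line onto the unit interval. *)
Definition clamp {R : realType} (u : R) : R := Num.max 0 (Num.min u 1).

Lemma clamp_continuous {R : realType} : continuous (@clamp R).
Proof.
move=> u; apply: (@continuous_max _ _ (cst 0) (fun u : R => Num.min u 1)).
  exact: cvg_cst.
by apply: (@continuous_min _ _ id (cst 1)); [exact: id|exact: cvg_cst].
Qed.

Lemma clamp01 {R : realType} (u : R) : 0 <= clamp u <= 1.
Proof. by rewrite /clamp le_max lexx ge_max ler01 ge_min lexx orbT. Qed.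

Lemma clampE {R : realType} (u : R) : 0 <= u <= 1 -> clamp u = u.
Proof. by case/andP => u0 u1; rewrite /clamp min_l// max_r. Qed.

(** * From interval fibers to an injective path *)

(** With [h] the coordinate of [fiber_coordinate] and [j] a section of [h], extended
to the line by [clamp], the path is [g \o j]. For a closed set [C], the points of
the unit interval that the path maps into [C] are the images under [h] of those
that [g] maps into [C], hence form a compact set. *)
Lemma injective_reparametrization {R : realType} {X : topologicalType}
    (g : R -> X) :
  continuous g -> (forall x : X, closed [set x]) -> convex_fibers g ->
  g 0 <> g 1 ->
  exists c : R -> X, [/\ continuous c, c 0 = g 0, c 1 = g 1 &
    forall u v, 0 <= u <= 1 -> 0 <= v <= 1 -> c u = c v -> u = v].
Proof.
move=> ctg T1 cg g01.
have zin : 0 <= (0 : R) <= 1 by rewrite lexx ler01.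
have oin : 0 <= (1 : R) <= 1 by rewrite lexx ler01.
have [p pP] : exists p : R -> R * R, fiber_ends g (fst \o p) (snd \o p).
  have [|p pP] := (@choice _ _ (fun t p => 0 <= t <= 1 ->
    [/\ 0 <= p.1 <= t, t <= p.2 <= 1, g p.1 = g t, g p.2 = g t
      & forall s, 0 <= s <= 1 -> g s = g t -> p.1 <= s <= p.2])); last by exists p.
  move=> t.
  have [t01|nt01] := boolP (0 <= t <= 1); last first.
    by exists (0, 0) => t01; case/negP: nt01.
  pose F := [set s : R | 0 <= s] `&` [set s | s <= 1] `&` g @^-1` [set g t].
  have cF : closed F.
    apply: closedI; first by apply: closedI; [exact: closed_ge|exact: closed_le].
    by apply: closed_comp => // x _; exact: ctg.
  have Ft : F t by case/andP: t01.
  have [a [[[a0 a1] ga] _ at_ aF]] := closed_first_point cF Ft (proj1 (andP t01)).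
  have [b [[[b0 b1] gb] tb _ bF]] := closed_last_point cF Ft (proj2 (andP t01)).
  exists (a, b) => _; split => //=; [exact/andP|exact/andP|].
  move=> s /andP[s0 s1] gs; have Fs : F s by [].
  apply/andP; split; rewrite leNgt; apply/negP => h.
    exact: (aF _ s0 h).
  exact: (bF _ h s1).
have [h [ch h0 h1 hg]] := fiber_coordinate cg pP g01.
have [j jP] : exists j : R -> R, forall u, 0 <= j u <= 1 /\ h (j u) = clamp u.
  have [|j jP] := @choice _ _ (fun u t : R => 0 <= t <= 1 /\ h t = clamp u);
    last by exists j.
  move=> u; have := clamp01 u => c01.
  have [||t t01 ht] := @IVT R h 0 1 (clamp u) ler01.
  - exact: continuous_subspaceT.
  - by rewrite h0 h1 min_l// max_r.
  by exists t; split => //; rewrite in_itv in t01.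
exists (g \o j); split.
- apply/continuous_closedP => C cC.
  pose F : set R := `[0, 1]%classic `&` g @^-1` C.
  have kF : compact F.
    apply: (subclosed_compact _ (@segment_compact R 0 1)); last by move=> x [].
    apply: closedI; first exact: itv_closed.
    by apply: closed_comp => // x _; exact: ctg.
  have chF : closed (h @` F).
    apply: compact_closed; first exact: Rhausdorff.
    by apply: continuous_compact => //; exact: continuous_subspaceT.
  rewrite (_ : _ @^-1` _ = clamp @^-1` (h @` F)).
    by apply: closed_comp => // x _; exact: clamp_continuous.
  apply/seteqP; split => u /=; have [j01 hj] := jP u.
    by move=> Cu; exists (j u).
  move=> [t [t01 Ct] ht]; rewrite ((hg (j u) t _ _).1 _)//; last by rewrite hj.
- have [j01 e] := jP 0; apply: (hg (j 0) 0 j01 zin).1.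
  by rewrite e h0 clampE.
- have [j01 e] := jP 1; apply: (hg (j 1) 1 j01 oin).1.
  by rewrite e h1 clampE.
- move=> u v u01 v01 /= e; rewrite -(clampE u01) -(clampE v01).
  have [ju <-] := jP u; have [jv <-] := jP v.
  exact/hg.
Qed.

(** * Paths in Delta-Hausdorff spaces *)

Lemma open_nearby {R : realType} (U : set R) (x : R) : open U -> U x ->
  exists2 e : R, 0 < e & forall y, `|y - x| <= e -> U y.
Proof.
move=> oU Ux; have /nbhs_ballP[e /= e0 eU] : nbhs x U by exact: open_nbhs_nbhs.
exists (e / 2); first by rewrite divr_gt0.
move=> y yx; apply: eU; rewrite /ball /= distrC (le_lt_trans yx)//.
by rewrite ltr_pdivrMr// ltr_pMr// ltr1n.
Qed.

Section DeltaHausdorff.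
Context {R : realType} {X : topologicalType} (dh : delta_hausdorff R X).

Lemma closed_singleton (x : X) : closed [set x].
Proof.
have -> : [set x] = (fun _ : R => x) @` `[0, 1].
  apply/seteqP; split => [_ ->|_ [t _ <-]//].
  by exists 0 => //=; rewrite in_itv /= lexx ler01.
by apply: dh; apply: continuous_subspaceT => ?; exact: cvg_cst.
Qed.

Lemma closed_image_itv (f : R -> X) (a b : R) :
  continuous f -> closed (f @` `[a, b]).
Proof.
move=> cf; have [ab|ba] := leP a b; last first.
  rewrite (_ : _ @` _ = set0); first exact: closed0.
  rewrite -subset0 => _ [t /= + _]; rewrite in_itv /= => /andP[at_ tb].
  by have := le_trans at_ tb; rewrite leNgt ba.
pose q (u : R) : R := a + (b - a) * u.
have cq : continuous q.
  move=> u; apply: cvgD; first exact: cvg_cst.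
  by apply: cvgMr; exact: cvg_id.
rewrite (_ : _ @` _ = (f \o q) @` `[0, 1]).
  apply: dh; apply: continuous_subspaceT => u.
  by apply: continuous_comp; [exact: cq|exact: cf].
apply/seteqP; split => [_ [t /= + <-]|_ [u /= + <-]]; rewrite !in_itv /=.
- move=> /andP[at_ tb].
  have [e|ne] := eqVneq a b.
    exists 0; first by rewrite in_itv /= lexx ler01.
    by congr f; rewrite /q mulr0 addr0; apply: le_anti; rewrite at_ e tb.
  have ba : 0 < b - a by rewrite subr_gt0 lt_neqAle ne.
  exists ((t - a) / (b - a)).
    rewrite in_itv /= divr_ge0 ?subr_ge0//= ler_pdivrMr// mul1r.
    by rewrite lerB.
  by congr f; rewrite /q mulrC divfK ?gt_eqF// addrC subrK.
- move=> /andP[u0 u1]; exists (q u) => //; rewrite in_itv /= /q.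
  have d0 : 0 <= b - a by rewrite subr_ge0.
  have := mulr_ge0 d0 u0; have := ler_piMr d0 u1 => h1 h2.
  by apply/andP; split; lra.
Qed.

(** The relation [f s = f t] is closed, although [X] is not assumed Hausdorff. *)
Lemma separated_values (f : R -> X) (s t : R) : continuous f -> f s <> f t ->
  exists2 e : R, 0 < e & forall s' t', `|s' - s| <= e -> `|t' - t| <= e ->
    f s' <> f t'.
Proof.
move=> cf fst_.
have oU : open (f @^-1` ~` [set f t]).
  by apply: open_comp; [move=> x _; exact: cf|rewrite openC; exact: closed_singleton].
have [e1 e10 He1] := open_nearby oU fst_.
have oV : open (f @^-1` ~` (f @` `[s - e1, s + e1])).
  by apply: open_comp; [move=> x _; exact: cf|rewrite openC; exact: closed_image_itv].
have [|e2 e20 He2] := @open_nearby _ _ t oV.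
  move=> [u /= uI fu]; apply: (He1 u) => //.
  by move: uI; rewrite in_itv /= ler_distl.
exists (Num.min e1 e2); first by rewrite lt_min e10.
move=> s' t'; rewrite !le_min => /andP[h1 _] /andP[_ h2] e.
apply: (He2 t' h2); exists s' => //=.
by rewrite in_itv /= -ler_distl.
Qed.

End DeltaHausdorff.

(** Only images of intervals are known to be closed, so the continuity of the inverse
at [c u] is checked on the complement of the images of the two intervals that
remain when a neighbourhood of [u] is removed. *)
Lemma injective_path_embedding {R : realType} {X : topologicalType}
    (c : R -> X) :
  delta_hausdorff R X -> continuous c ->
  (forall u v, 0 <= u <= 1 -> 0 <= v <= 1 -> c u = c v -> u = v) ->
  embedding_on (`[0, 1]%classic : set R) c.
Proof.
move=> dh cc inj.
(* the inverse of c, with the value 0 outside of the image *)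
pose k y := xget 0 [set u : R | 0 <= u <= 1 /\ c u = y].
have kP u : 0 <= u <= 1 -> 0 <= k (c u) <= 1 /\ c (k (c u)) = c u.
  move=> u01; rewrite /k; case: xgetP => [x _ //|/(_ u) H].
  by exfalso; apply: H.
have kc u : 0 <= u <= 1 -> k (c u) = u.
  by move=> u01; have [k01 ck] := kP u u01; exact: inj.
exists k; split.
- by move=> u u01; exists u.
- by move=> _ [u /= u01 <-]; rewrite kc //; move: u01; rewrite in_itv.
- by move=> u /=; rewrite in_itv /=; exact: kc.
- by move=> _ [u /= u01 <-]; rewrite kc //; move: u01; rewrite in_itv.
split; first exact: continuous_subspaceT.
apply/subspace_continuousP => _ [u /= + <-]; rewrite in_itv /= => u01.
rewrite /from_subspace kc//; apply/cvgrPdist_lt => e e0.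
pose O := ~` (c @` `[0, u - e]) `&` ~` (c @` `[u + e, 1]).
have oO : open O by apply: openI; rewrite openC; exact: closed_image_itv.
have Ou : O (c u).
  split=> -[v /=]; rewrite in_itv /= => /andP[a b] /inj.
    by move=> /(_ _ u01) vu; have : v = u by [apply: vu; lra]; lra.
  by move=> /(_ _ u01) vu; have : v = u by [apply: vu; lra]; lra.
suff H : nbhs (c u) (fun z => (c @` `[0, 1]) z -> `|u - k z| < e) by exact: H.
apply: filterS (open_nbhs_nbhs (conj oO Ou)) => z [nl nr] [v /= + vz].
rewrite -vz in nl nr *; rewrite in_itv /= => v01; rewrite kc // ltr_norml.
have h1 : u - e < v.
  rewrite ltNge; apply/negP => h; apply: nl.
  by exists v => //=; rewrite in_itv /= h; case/andP: v01 => ->.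
have h2 : v < u + e.
  rewrite ltNge; apply/negP => h; apply: nr.
  by exists v => //=; rewrite in_itv /= h; case/andP: v01.
by apply/andP; split; lra.
Qed.

(** * Erasing the loops of a path *)

(** A compact set covered by a chain of open sets lies in one of them. *)
Lemma chain_compact_cover {T : ptopologicalType} (F : set (set T)) (K : set T) :
  total_on F subset -> (forall U, F U -> open U) -> compact K -> K !=set0 ->
  K `<=` \bigcup_(U in F) U -> exists2 U, F U & K `<=` U.
Proof.
move=> tF oF; rewrite compact_cover => cK [x Kx] KF.
have [D' D'F KD'] := cK _ F id oF KF.
have [U0 FU0 _] := KF _ Kx.
have [U FU DU] : exists2 U, F U & forall V, V \in finmap.enum_fset D' -> V `<=` U.
  have : forall V, V \in finmap.enum_fset D' -> F V by move=> V /D'F; rewrite inE.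
  elim: (finmap.enum_fset D') => [|V s IH] sF; first by exists U0.
  have [W FW sW] := IH (fun Z Zs => sF Z (mem_behead (s := V :: s) Zs)).
  have FV : F V by apply: sF; rewrite mem_head.
  have [VW|WV] := tF _ _ FV FW.
    exists W => // Z; rewrite in_cons => /orP[/eqP->//|]; exact: sW.
  exists V => // Z; rewrite in_cons => /orP[/eqP->//|/sW ZW].
  exact: subset_trans ZW WV.
by exists U => // y /KD'[V /= VD' Vy]; exact: (DU V VD').
Qed.

(** Open subsets of the open unit interval whose components are loops of [f]. The
components are encoded as the intervals between two points of the complement
with no other point of the complement between them. *)
Definition loop_set {R : realType} {X : Type} (f : R -> X) (U : set R) :=
  [/\ open U, U `<=` `]0, 1[ &
    forall s t, s < t -> ~ U s -> ~ U t -> (forall u, s < u -> u < t -> U u) ->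
      f s = f t].

Section MaximalLoops.
Context {R : realType} {X : topologicalType} (dh : delta_hausdorff R X).
Context (f : R -> X) (cf : continuous f).

(** If [s, t] bounds a component of the union and [f s] differs from [f t], then one
member of the chain contains all of that component but small neighbourhoods of
[s] and [t]; it has a component whose ends are close to [s] and [t], where [f]
takes equal values, against [separated_values]. *)
Lemma loop_set_bigcup (F : set (set R)) :
  F `<=` loop_set f -> total_on F subset -> loop_set f (\bigcup_(U in F) U).
Proof.
move=> FP tF; split.
- by apply: bigcup_open => U /FP[].
- by move=> u [U /FP[_ + _]]; apply.
move=> s t st nUs nUt sub; apply: contrapT => fst_.
have [d d0 Hd] := separated_values dh cf fst_.
(* a third of the length, so that the truncated interval is not empty *)
pose e := Num.min d ((t - s) / 3).
have ed : e <= d by rewrite ge_min lexx.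
have es : e <= (t - s) / 3 by rewrite ge_min lexx orbT.
have e0 : 0 < e by rewrite lt_min d0 divr_gt0 ?subr_gt0.
have [U FU UI] : exists2 U, F U & `[s + e, t - e] `<=` U.
  apply: chain_compact_cover => //.
  - by move=> U /FP[].
  - exact: segment_compact.
  - by exists (s + e) => /=; rewrite in_itv /= lexx; lra.
  - by move=> u /=; rewrite in_itv /= => /andP[h1 h2]; apply: sub; lra.
have [oU _ HU] := FP _ FU.
have cU : closed (~` U) by rewrite closedC.
have Us : (~` U) s by move=> Us; apply: nUs; exists U.
have Ut : (~` U) t by move=> Ut; apply: nUt; exists U.
have [||a [Ua sa ae Ha]] := @closed_last_point _ _ s (s + e) cU => //; first by lra.
have [||b [Ub eb bt Hb]] := @closed_first_point _ _ (t - e) t cU => //; first by lra.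
apply: (Hd a b).
- by rewrite ger0_norm; lra.
- by rewrite ler0_norm; lra.
apply: HU => //; first by lra.
move=> u au ub; have [h1|h1] := leP u (s + e).
  by apply: contrapT; exact: Ha.
have [h2|h2] := leP (t - e) u.
  by apply: contrapT; exact: Hb.
by apply: UI => /=; rewrite in_itv /=; apply/andP; split; lra.
Qed.

(** If [s] and [t] lie outside of a maximal set and [f s = f t], then adding the open
interval from [s] to [t] to that set gives a loop set again. *)
Lemma maximal_loop_set : exists2 U, loop_set f U &
  forall s t, 0 <= s -> s < t -> t <= 1 -> ~ U s -> ~ U t -> f s = f t ->
    forall u, s < u -> u < t -> U u.
Proof.
have [U [lU mU]] := Zorn_bigcup loop_set_bigcup.
exists U => // s t s0 st t1 nUs nUt fst_.
have [oU U01 HU] := lU.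
pose B := U `|` `]s, t[.
have PB : loop_set f B.
  split.
  - by apply: openU => //; exact: itv_open.
  - move=> u [/U01//|/=]; rewrite !in_itv /= => /andP[su ut].
    by rewrite (le_lt_trans s0 su) (lt_le_trans ut t1).
  move=> s' t' s't' nBs' nBt' sub.
  have nUs' : ~ U s' by move=> h; apply: nBs'; left.
  have nUt' : ~ U t' by move=> h; apply: nBt'; left.
  have ns' : ~ s < s' < t by move=> h; apply: nBs'; right; rewrite /= in_itv.
  have nt' : ~ s < t' < t by move=> h; apply: nBt'; right; rewrite /= in_itv.
  have nB v : ~ U v -> v = s \/ v = t -> ~ B v.
    by move=> nU e [//|/=]; rewrite in_itv /=; case: e => ->; rewrite ltxx ?andbF.
  have nBs : ~ B s by apply: nB => //; left.
  have nBt : ~ B t by apply: nB => //; right.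
  have [allU|] := pselect (forall u, s' < u -> u < t' -> U u); first exact: HU.
  move=> /existsNP[u] /not_implyP[s'u] /not_implyP[ut'] nUu.
  have : B u by exact: sub.
  case=> [//|/=]; rewrite in_itv /= => /andP[su ut].
  have s's : s' <= s.
    by rewrite leNgt; apply/negP => h; apply: ns'; rewrite h (lt_trans s'u).
  have tt' : t <= t'.
    by rewrite leNgt; apply/negP => h; apply: nt'; rewrite h andbT (lt_trans su).
  have -> : s' = s.
    apply: contrapT => /eqP ne; apply: nBs; apply: sub.
      by rewrite lt_neqAle ne.
    exact: lt_trans ut'.
  have -> // : t' = t.
  apply: contrapT => /eqP ne; apply: nBt; apply: sub.
    exact: lt_trans ut.
  by rewrite lt_neqAle eq_sym ne.
move=> u su ut; apply: contrapT => nUu; apply: (mU B) => //; split.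
  by move=> v Uv; left.
by move=> /(_ u) BU; apply/nUu/BU; right; rewrite /= in_itv /= su.
Qed.

(** The path [g] maps [t] to [f (p t)], where [p t] is the last point at or before
[t] outside of a maximal loop set; the first such point [n t] at or after [t]
gives the same value. *)
Lemma monotone_path_exists : exists g : R -> X,
  [/\ continuous g, g 0 = f 0, g 1 = f 1 & convex_fibers g].
Proof.
have [U [oU U01 HU] mU] := maximal_loop_set.
have cU : closed (~` U) by rewrite closedC.
have U0 t : t <= 0 -> (~` U) t.
  by move=> t0 /U01 /=; rewrite in_itv /= ltNge t0.
have U1 t : 1 <= t -> (~` U) t.
  by move=> t1 /U01 /=; rewrite in_itv /= (ltNge t) t1 andbF.
have [|p pP] := @choice _ _ (fun t a : R => [/\ ~ U a, a <= t,
    0 <= t -> 0 <= a & forall u, a < u -> u <= t -> U u]).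
  move=> t; have m0 : Num.min t 0 <= 0 by rewrite ge_min lexx orbT.
  have mt : Num.min t 0 <= t by rewrite ge_min lexx.
  have [a [Ua ma at_ Ha]] := closed_last_point cU (U0 _ m0) mt.
  exists a; split => //; first by move=> t0; rewrite min_r in ma.
  by move=> u au ut; apply: contrapT; exact: Ha.
have [|n nP] := @choice _ _ (fun t b : R => [/\ ~ U b, t <= b
    & forall u, t <= u -> u < b -> U u]).
  move=> t; have m1 : 1 <= Num.max t 1 by rewrite le_max lexx orbT.
  have tm : t <= Num.max t 1 by rewrite le_max lexx.
  have [b [Ub tb bm Hb]] := closed_first_point cU (U1 _ m1) tm.
  exists b; split => //.
  by move=> u tu ub; apply: contrapT; exact: Hb.
have pE t : ~ U t -> p t = t.
  move=> nUt; have [_ pt _ H] := pP t; apply/eqP; rewrite eq_le pt leNgt.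
  by apply/negP => h; apply: nUt; exact: H.
have nE t : ~ U t -> n t = t.
  move=> nUt; have [_ tn H] := nP t; apply/eqP; rewrite eq_le tn andbT leNgt.
  by apply/negP => h; apply: nUt; exact: H.
have fpn t : f (p t) = f (n t).
  have [Ut|nUt] := pselect (U t); last by rewrite pE// nE.
  have [Up pt _ Hp] := pP t; have [Un tn Hn] := nP t.
  apply: HU => //.
    rewrite lt_neqAle (le_trans pt tn) andbT; apply/eqP => e.
    by apply: Up; rewrite (_ : p t = t)//; apply/le_anti; rewrite pt e tn.
  move=> u pu un; have [ut|tu] := leP u t; first exact: Hp.
  by apply: Hn => //; exact: ltW.
have ple k t : ~ U k -> k <= t -> k <= p t.
  move=> nUk kt; rewrite leNgt; apply/negP => h.
  by have [_ _ _ H] := pP t; apply: nUk; exact: H.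
have nle k t : ~ U k -> t <= k -> n t <= k.
  move=> nUk kt; rewrite leNgt; apply/negP => h.
  by have [_ _ H] := nP t; apply: nUk; exact: H.
exists (f \o p); split => /=.
- move=> t W /=; rewrite nbhs_simpl /= => Wt.
  have [Ut|nUt] := pselect (U t).
    have [e e0 He] := open_nearby oU Ut.
    apply/nbhs_ballP; exists e => //= s; rewrite /ball /= => ts.
    rewrite (_ : p s = p t); first exact: nbhs_singleton.
    have [Us ps _ _] := pP s; have [Ut' pt _ _] := pP t.
    have inU v : (s <= v <= t) || (t <= v <= s) -> U v.
      move=> h; apply: He; move: ts; rewrite ltr_norml ler_norml => /andP[a b].
      by case/orP: h => /andP[c d]; apply/andP; split; lra.
    apply/le_anti/andP; split.
    + apply: ple => //; rewrite leNgt; apply/negP => h; apply: Us.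
      by apply: inU; rewrite (ltW h) ps orbT.
    + apply: ple => //; rewrite leNgt; apply/negP => h; apply: Ut'.
      by apply: inU; rewrite (ltW h) pt.
  (* outside of U, points on the right are compared with p, on the left with n *)
  rewrite pE// in Wt.
  have /nbhs_ballP[e /= e0 He] := cf Wt.
  apply/nbhs_ballP; exists e => //= s; rewrite /ball /= => ts.
  move: ts; rewrite ltr_norml => /andP[a b].
  have [h|/ltW h] := leP s t.
    rewrite fpn; apply: He; rewrite /ball /= ltr_norml.
    have := nle _ _ nUt h; have [_ sn _] := nP s => nt.
    by apply/andP; split; lra.
  apply: He; rewrite /ball /= ltr_norml.
  have := ple _ _ nUt h; have [_ ps _ _] := pP s => tp.
  by apply/andP; split; lra.
- by rewrite pE//; exact: U0.
- by rewrite pE//; exact: U1.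
move=> s u t s0 su ut t1 /= fst_.
have pm a b : a <= b -> p a <= p b.
  by have [Ua pa _ _] := pP a => ab; apply: ple => //; exact: le_trans ab.
have psu := pm _ _ su; have put := pm _ _ ut.
have [nUs _ s0' _] := pP s; have [nUt pt _ _] := pP t; have [nUu _ _ _] := pP u.
have [e|ne] := eqVneq (p u) (p s); first by rewrite e.
have [e|ne'] := eqVneq (p u) (p t); first by rewrite e.
case: nUu; apply: (mU (p s) (p t)) => //.
- exact: s0'.
- by rewrite (lt_le_trans _ put)// lt_neqAle eq_sym ne.
- exact: le_trans t1.
- by rewrite lt_neqAle eq_sym ne.
- by rewrite lt_neqAle ne'.
Qed.

End MaximalLoops.

(** * Arcwise connectedness *)

(** Every path can be parametrized by the unit interval and extended to a continuous
map on the line, constant on both sides. *)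
Lemma path_extension {R : realType} {X : topologicalType} (a b : R)
    (f : R -> X) (x y : X) :
  a <= b -> is_path_from_to a b f x y ->
  exists F : R -> X, [/\ continuous F, F 0 = x & F 1 = y].
Proof.
move=> ab [cf fa fb].
pose q (u : R) : R := a + (b - a) * clamp u.
have d0 : 0 <= b - a by rewrite subr_ge0.
have qab u : `[a, b]%classic (q u).
  have /andP[u0 u1] := clamp01 u; rewrite /= in_itv /= /q.
  have := mulr_ge0 d0 u0; have := ler_piMr d0 u1 => h1 h2.
  by apply/andP; split; lra.
have cq : continuous q.
  move=> u; apply: cvgD; first exact: cvg_cst.
  by apply: cvgMr; exact: clamp_continuous.
exists (f \o q); split => /=.
- move=> u W /= Wu; have /subspace_continuousP/(_ _ (qab u) W Wu) := cf.
  move=> H; have : nbhs (q u) (fun z => `[a, b]%classic z -> W (f z)) by exact: H.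
  move=> Wq; have {}Wq : nbhs u (fun v => `[a, b]%classic (q v) -> W (f (q v))).
    exact: cq u _ Wq.
  by apply: filterS Wq => v /(_ (qab v)).
- by rewrite /q clampE ?mulr0 ?addr0 ?lexx ?ler01.
- have e : clamp (1 : R) = 1 by rewrite clampE ?ler01 ?lexx.
  by rewrite /q e mulr1 addrC subrK.
Qed.

Theorem theorem7 (R : realType) (X : topologicalType) :
  path_connected R X -> delta_hausdorff R X -> arcwise_connected R X.
Proof.
move=> pc dh x y xy.
have [a [b [f0 [ab /(path_extension ab)[f [cf fx fy]]]]]] := pc x y.
have [g [cg g0 g1 mg]] := monotone_path_exists dh cf.
have [|c [cc c0 c1 ic]] := injective_reparametrization cg (closed_singleton dh) mg.
  by rewrite g0 g1 fx fy.
exists c; split; last exact: injective_path_embedding.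
split; first exact: continuous_subspaceT.
- by rewrite c0 g0.
- by rewrite c1 g1.
Qed.
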